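(* For $r\in(0,1)$ let $$f_{18}(r)=\frac{1}{r^8}\left[\left(1-\frac12r^2-\frac{1}{16}r^4-\frac{1}{32}r^6\right)\mathcal{K}(r)-\mathcal{E}(r)\right].$$ Then the function $f_{19}(r)=f_{18}(r)/\mathcal{K}(r)$ is strictly increasing from $(0,1)$ onto $(41/2048,13/32)$. In particular, for $r\in(0,1)$, $$P(r)<\frac{\mathcal{E}(r)}{\mathcal{K}(r)}<Q(r),$$ where $Q(r)=1-\frac{r^2}{2}-\frac{r^4}{16}-\frac{r^6}{32}-\frac{41r^8}{2048}$ and $$P(r)=1-\frac12r^2-\frac{1}{16}r^4-\frac{1}{32}r^6-\frac{13}{32}r^8=(1-r^2)\left(1+r^2\,\frac{16+14r^2+13r^4}{32}\right).$$
   Context: For $r\in(0,1)$, $\mathcal{K}(r)=\int_0^{\pi/2}(1-r^2\sin^2t)^{-1/2}\,dt$ and $\mathcal{E}(r)=\int_0^{\pi/2}(1-r^2\sin^2t)^{1/2}\,dt$ are the complete elliptic integrals of the first and second kinds. *)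

(* Defs.v *)
From Stdlib Require Import Reals.
From Coquelicot Require Import Coquelicot.
Open Scope R_scope.

(* Complete elliptic integrals as functions of the modulus r (not of the
   parameter m = r^2).  For 0 < r < 1 the integrands are continuous on
   [0, PI/2], so the total integral RInt is the Riemann integral. *)
Definition ellipticK (r : R) : R :=
  RInt (fun t => / sqrt (1 - r ^ 2 * sin t ^ 2)) 0 (PI / 2).

Definition ellipticE (r : R) : R :=
  RInt (fun t => sqrt (1 - r ^ 2 * sin t ^ 2)) 0 (PI / 2).

Definition f18 (r : R) : R :=
  1 / r ^ 8 *
  ((1 - 1 / 2 * r ^ 2 - 1 / 16 * r ^ 4 - 1 / 32 * r ^ 6) * ellipticK r
   - ellipticE r).

Definition f19 (r : R) : R := f18 r / ellipticK r.

Definition P (r : R) : R :=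
  1 - 1 / 2 * r ^ 2 - 1 / 16 * r ^ 4 - 1 / 32 * r ^ 6 - 13 / 32 * r ^ 8.

Definition Q (r : R) : R :=
  1 - r ^ 2 / 2 - r ^ 4 / 16 - r ^ 6 / 32 - 41 * r ^ 8 / 2048.

(* Main.v *)
Require Import Defs.
From Stdlib Require Import Reals Lra.
From Coquelicot Require Import Coquelicot.
Open Scope R_scope.

(* With [x = r ^ 2], the function [w = 1 - E / K] solves the Riccati equation
   [2 x (1 - x) w' = x - 2 x w + w ^ 2], so that its Taylor coefficients satisfy
   [c_1 = 1/2] and [2 n c_n = 2 (n - 2) c_(n-1) + sum_i c_i c_(n-i)] and are all
   nonnegative.  Instead of summing the series, one divides out the leading terms
   one at a time: if [w = p_n + x ^ (n+1) y] with [p_n] the Taylor polynomial of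
   degree [n] and [y] positive and bounded near [0], then [y] is strictly
   increasing with limit [c_(n+1)] at [0], so [(y - c_(n+1)) / x] is again
   positive and bounded near [0].  For [n = 3] the quotient [y] is [f19], and its
   limit at [x = 1] is obtained from [K -> oo]. *)

(** * Complete elliptic integrals as functions of the parameter [x = r ^ 2] *)

Definition ellK (x : R) : R :=
  RInt (fun t => / sqrt (1 - x * sin t ^ 2)) 0 (PI / 2).

Definition ellE (x : R) : R :=
  RInt (fun t => sqrt (1 - x * sin t ^ 2)) 0 (PI / 2).

Lemma sin_sqr_bounds (t : R) : 0 <= sin t ^ 2 <= 1.
Proof.
pose proof (sin2_cos2 t) as H; unfold Rsqr in H.
assert (0 <= cos t * cos t) by nra.
split; nra.
Qed.

Lemma one_minus_sin_sqr_pos (x t : R) : 0 < x < 1 -> 0 < 1 - x * sin t ^ 2.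
Proof. intros Hx; pose proof (sin_sqr_bounds t); nra. Qed.

Lemma locally_unit_interval (x : R) (D : R -> Prop) :
  (forall y, 0 < y < 1 -> D y) -> 0 < x < 1 -> locally x D.
Proof.
intros HD Hx.
apply (locally_open (fun y => 0 < y /\ y < 1)); [| exact HD | exact Hx].
apply open_and; [apply open_gt | apply open_lt].
Qed.

Lemma continuous_modulus (g : R -> R) (x t : R) :
  (forall u, 0 < u -> continuous g u) -> 0 < x < 1 ->
  continuous (fun t => g (1 - x * sin t ^ 2)) t.
Proof.
intros Hg Hx.
apply (continuous_comp (fun t => 1 - x * sin t ^ 2) g).
- apply (ex_derive_continuous (fun t => 1 - x * sin t ^ 2)).
  auto_derive; exact I.
- now apply Hg, one_minus_sin_sqr_pos.
Qed.

(** * Differentiation of the integrals with respect to the parameter *)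

Lemma is_derive_modulus_RInt (f df : R -> R) (x : R) :
  (forall u, 0 < u -> is_derive f u (df u)) ->
  (forall u, 0 < u -> continuous df u) ->
  0 < x < 1 ->
  is_derive (fun x => RInt (fun t => f (1 - x * sin t ^ 2)) 0 (PI / 2)) x
            (RInt (fun t => - sin t ^ 2 * df (1 - x * sin t ^ 2)) 0 (PI / 2)).
Proof.
intros Hf Hdf Hx.
assert (Hd : forall y t, 0 < y < 1 ->
  is_derive (fun u => f (1 - u * sin t ^ 2)) y
            (- sin t ^ 2 * df (1 - y * sin t ^ 2))).
{ intros y t Hy.
  apply (is_derive_comp f (fun u => 1 - u * sin t ^ 2)).
  - now apply Hf, one_minus_sin_sqr_pos.
  - auto_derive; [exact I | ring]. }
rewrite (RInt_ext _ (fun t => Derive (fun u => f (1 - u * sin t ^ 2)) x)).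
2:{ intros t _; symmetry; now apply is_derive_unique, Hd. }
apply (is_derive_RInt_param (fun x t => f (1 - x * sin t ^ 2))).
- apply locally_unit_interval with (2 := Hx); intros y Hy t _.
  eexists; now apply Hd.
- intros t _.
  apply (continuity_2d_pt_ext_loc
    (fun u v => - sin v ^ 2 * df (1 - u * sin v ^ 2))).
  + assert (Hr : 0 < Rmin x (1 - x)) by (apply Rmin_glb_lt; lra).
    exists (mkposreal _ Hr); intros u v Hu _; simpl in Hu.
    symmetry; apply is_derive_unique, Hd.
    pose proof (Rmin_l x (1 - x)); pose proof (Rmin_r x (1 - x)).
    apply Rabs_def2 in Hu; lra.
  + assert (Hs : continuity_2d_pt (fun _ v => sin v ^ 2) x t).
    { apply (continuity_1d_2d_pt_comp (fun v => sin v ^ 2) (fun _ v => v)).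
      - apply continuity_pt_filterlim.
        apply (ex_derive_continuous (fun v => sin v ^ 2)); auto_derive; exact I.
      - apply continuity_2d_pt_id2. }
    apply continuity_2d_pt_mult.
    * now apply continuity_2d_pt_opp.
    * apply (continuity_1d_2d_pt_comp df (fun u v => 1 - u * sin v ^ 2)).
      -- apply continuity_pt_filterlim, Hdf; now apply one_minus_sin_sqr_pos.
      -- apply continuity_2d_pt_minus; [apply continuity_2d_pt_const |].
         apply continuity_2d_pt_mult; [apply continuity_2d_pt_id1 | exact Hs].
- apply locally_unit_interval with (2 := Hx); intros y Hy.
  apply (ex_RInt_continuous (fun t => f (1 - y * sin t ^ 2))); intros t _.
  apply continuous_modulus; [| exact Hy].
  intros u Hu; apply (ex_derive_continuous f); eexists; now apply Hf.
Qed.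

Lemma continuous_sqrt_pos (u : R) : 0 < u -> continuous sqrt u.
Proof. intros Hu; apply (ex_derive_continuous sqrt); auto_derive; lra. Qed.

Lemma continuous_inv_sqrt (u : R) : 0 < u -> continuous (fun u => / sqrt u) u.
Proof.
intros Hu; apply (ex_derive_continuous (fun u => / sqrt u)).
pose proof (sqrt_lt_R0 u Hu); auto_derive; repeat split; lra.
Qed.

Lemma continuous_inv_sqrt3 (u : R) :
  0 < u -> continuous (fun u => / sqrt u ^ 3) u.
Proof.
intros Hu; apply (ex_derive_continuous (fun u => / sqrt u ^ 3)).
pose proof (sqrt_lt_R0 u Hu); auto_derive; repeat split; [lra |].
apply Rgt_not_eq; simpl; repeat apply Rmult_lt_0_compat; lra.
Qed.

Lemma is_RInt_modulus (g : R -> R) (x : R) :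
  (forall u, 0 < u -> continuous g u) -> 0 < x < 1 ->
  is_RInt (fun t => g (1 - x * sin t ^ 2)) 0 (PI / 2)
          (RInt (fun t => g (1 - x * sin t ^ 2)) 0 (PI / 2)).
Proof.
intros Hg Hx.
apply (RInt_correct (fun t => g (1 - x * sin t ^ 2))).
apply (ex_RInt_continuous (fun t => g (1 - x * sin t ^ 2))); intros t _.
now apply continuous_modulus.
Qed.

Lemma RInt_linear_combination (f g h : R -> R) (a b u v If Ig : R) :
  is_RInt f a b If -> is_RInt g a b Ig ->
  (forall t, h t = u * f t + v * g t) -> RInt h a b = u * If + v * Ig.
Proof.
intros Hf Hg Hh; apply is_RInt_unique.
apply (is_RInt_ext (fun t => plus (scal u (f t)) (scal v (g t)))).
- intros t _; symmetry; apply Hh.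
- now apply (is_RInt_plus (fun t => scal u (f t)) (fun t => scal v (g t)));
    apply (is_RInt_scal (V := R_NormedModule)).
Qed.

(* Integrates the derivative of [sin t * cos t / sqrt (1 - x * sin t ^ 2)],
   which vanishes at both ends of [[0, PI / 2]]. *)
Lemma RInt_inv_sqrt3 (x : R) : 0 < x < 1 ->
  RInt (fun t => / sqrt (1 - x * sin t ^ 2) ^ 3) 0 (PI / 2) = ellE x / (1 - x).
Proof.
intros Hx.
set (h := fun t => sin t * cos t / sqrt (1 - x * sin t ^ 2)).
set (dh := fun t => (sqrt (1 - x * sin t ^ 2)
                     - (1 - x) * / sqrt (1 - x * sin t ^ 2) ^ 3) / x).
assert (Hh : is_RInt dh 0 (PI / 2) (minus (h (PI / 2)) (h 0))).
{ apply (is_RInt_derive h dh).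
  - intros t _; unfold h, dh.
    pose proof (one_minus_sin_sqr_pos x t Hx) as Hp.
    pose proof (sqrt_lt_R0 _ Hp) as Hs.
    pose proof (sqrt_sqrt _ (Rlt_le _ _ Hp)) as Hss.
    pose proof (sin2_cos2 t) as Hsc; unfold Rsqr in Hsc.
    auto_derive;
      replace (1 + - (x * (sin t * (sin t * 1)))) with (1 - x * sin t ^ 2)
        by ring; [repeat split; lra |].
    set (q := sqrt _) in *.
    field_simplify_eq; [| repeat split; lra].
    replace (q ^ 4) with ((q * q) * (q * q)) by ring.
    replace (q ^ 2) with (q * q) by ring.
    rewrite Hss.
    replace (cos t ^ 2) with (1 - sin t ^ 2) by (simpl; lra).
    ring.
  - intros t _; unfold dh.
    apply (continuous_modulus (fun u => (sqrt u - (1 - x) * / sqrt u ^ 3) / x));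
      [| exact Hx].
    intros u Hu.
    apply (continuous_mult (fun u => sqrt u - (1 - x) * / sqrt u ^ 3)
             (fun _ => / x)); [| apply continuous_const].
    apply (continuous_minus sqrt (fun u => (1 - x) * / sqrt u ^ 3));
      [now apply continuous_sqrt_pos |].
    apply (continuous_mult (fun _ => 1 - x) (fun u => / sqrt u ^ 3));
      [apply continuous_const | now apply continuous_inv_sqrt3]. }
pose proof (is_RInt_modulus sqrt x continuous_sqrt_pos Hx) as HE.
pose proof (is_RInt_modulus (fun u => / sqrt u ^ 3) x continuous_inv_sqrt3 Hx)
  as HJ.
set (J := RInt (fun t => / sqrt (1 - x * sin t ^ 2) ^ 3) 0 (PI / 2)) in *.
assert (HJE : RInt dh 0 (PI / 2) = / x * ellE x + - ((1 - x) / x) * J).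
{ apply (RInt_linear_combination _ _ _ _ _ _ _ _ _ HE HJ).
  intros t; unfold dh; field.
  pose proof (sqrt_lt_R0 _ (one_minus_sin_sqr_pos x t Hx)); split; lra. }
assert (Hh0 : minus (h (PI / 2)) (h 0) = 0).
{ unfold h; rewrite cos_PI2, sin_0; unfold minus, plus, opp; simpl.
  unfold Rdiv; ring. }
rewrite Hh0 in Hh; rewrite (is_RInt_unique _ _ _ _ Hh) in HJE.
assert (H0 : ellE x + - (1 - x) * J = 0).
{ replace (ellE x + - (1 - x) * J) with
    (x * (/ x * ellE x + - ((1 - x) / x) * J)) by (field; lra).
  rewrite <- HJE; ring. }
apply Rmult_eq_reg_r with (1 - x); [| lra].
unfold Rdiv; rewrite Rmult_assoc, Rinv_l by lra; lra.
Qed.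

(** With [q = sqrt (1 - x * sin t ^ 2)], the differentiated integrand is [(q - / q) / (2 * x)],
    because [x * sin t ^ 2 = 1 - q ^ 2]. *)
Lemma is_derive_ellE (x : R) : 0 < x < 1 ->
  is_derive ellE x ((ellE x - ellK x) / (2 * x)).
Proof.
intros Hx.
replace ((ellE x - ellK x) / (2 * x)) with
  (RInt (fun t => - sin t ^ 2 * (/ (2 * sqrt (1 - x * sin t ^ 2)))) 0 (PI / 2)).
{ apply (is_derive_modulus_RInt sqrt (fun u => / (2 * sqrt u)));
    [| | exact Hx].
  - intros u Hu; auto_derive; [lra |].
    field; apply Rgt_not_eq, sqrt_lt_R0, Hu.
  - intros u Hu; apply (ex_derive_continuous (fun u => / (2 * sqrt u))).
    pose proof (sqrt_lt_R0 u Hu); auto_derive; repeat split; lra. }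
pose proof (is_RInt_modulus sqrt x continuous_sqrt_pos Hx) as HE.
pose proof (is_RInt_modulus (fun u => / sqrt u) x continuous_inv_sqrt Hx) as HK.
replace ((ellE x - ellK x) / (2 * x)) with
  (/ (2 * x) * ellE x + - / (2 * x) * ellK x) by (field; lra).
apply (RInt_linear_combination _ _ _ _ _ _ _ _ _ HE HK).
intros t.
pose proof (one_minus_sin_sqr_pos x t Hx) as Hp.
pose proof (sqrt_lt_R0 _ Hp) as Hs.
pose proof (sqrt_sqrt _ (Rlt_le _ _ Hp)) as Hss.
set (q := sqrt _) in *.
field_simplify_eq; [| repeat split; lra].
replace (q ^ 2) with (q * q) by ring; rewrite Hss; ring.
Qed.

(** As for [ellE], the differentiated integrand becomes [(/ q ^ 3 - / q) / (2 * x)];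
    [RInt_inv_sqrt3] integrates the first term. *)
Lemma is_derive_ellK (x : R) : 0 < x < 1 ->
  is_derive ellK x ((ellE x - (1 - x) * ellK x) / (2 * x * (1 - x))).
Proof.
intros Hx.
replace ((ellE x - (1 - x) * ellK x) / (2 * x * (1 - x))) with
  (RInt (fun t => - sin t ^ 2 * (- / (2 * sqrt (1 - x * sin t ^ 2) ^ 3)))
     0 (PI / 2)).
{ apply (is_derive_modulus_RInt (fun u => / sqrt u)
           (fun u => - / (2 * sqrt u ^ 3))); [| | exact Hx].
  - intros u Hu; pose proof (sqrt_lt_R0 u Hu).
    auto_derive; [repeat split; lra |].
    field; lra.
  - intros u Hu; apply (ex_derive_continuous (fun u => - / (2 * sqrt u ^ 3))).
    pose proof (sqrt_lt_R0 u Hu); auto_derive; repeat split; [lra |].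
    apply Rgt_not_eq, Rmult_lt_0_compat; [lra |].
    simpl; repeat apply Rmult_lt_0_compat; lra. }
assert (HJ : is_RInt (fun t => / sqrt (1 - x * sin t ^ 2) ^ 3) 0 (PI / 2)
               (ellE x / (1 - x))).
{ rewrite <- (RInt_inv_sqrt3 x Hx).
  apply (is_RInt_modulus (fun u => / sqrt u ^ 3) x continuous_inv_sqrt3 Hx). }
pose proof (is_RInt_modulus (fun u => / sqrt u) x continuous_inv_sqrt Hx) as HK.
replace ((ellE x - (1 - x) * ellK x) / (2 * x * (1 - x))) with
  (/ (2 * x) * (ellE x / (1 - x)) + - / (2 * x) * ellK x) by (field; lra).
apply (RInt_linear_combination _ _ _ _ _ _ _ _ _ HJ HK).
intros t.
pose proof (one_minus_sin_sqr_pos x t Hx) as Hp.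
pose proof (sqrt_lt_R0 _ Hp) as Hs.
pose proof (sqrt_sqrt _ (Rlt_le _ _ Hp)) as Hss.
set (q := sqrt _) in *.
field_simplify_eq; [| repeat split; lra].
replace (q ^ 2) with (q * q) by ring; rewrite Hss; ring.
Qed.

(** * Inequalities for the two integrals *)

Lemma sin_pos_PI2 (t : R) : 0 < t < PI / 2 -> 0 < sin t.
Proof. intros Ht; apply sin_gt_0; pose proof PI_RGT_0; lra. Qed.

Lemma ellE_lt_ellK (x : R) : 0 < x < 1 -> ellE x < ellK x.
Proof.
intros Hx; pose proof PI_RGT_0.
apply RInt_lt; [lra | | |].
- intros t _.
  apply (continuous_modulus (fun u => / sqrt u)); [exact continuous_inv_sqrt |].
  exact Hx.
- intros t _; now apply (continuous_modulus sqrt); [exact continuous_sqrt_pos |].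
- intros t Ht.
  pose proof (one_minus_sin_sqr_pos x t Hx) as Hp.
  pose proof (sqrt_lt_R0 _ Hp) as Hs.
  pose proof (sqrt_sqrt _ (Rlt_le _ _ Hp)) as Hss.
  pose proof (sin_pos_PI2 t Ht) as Hsin.
  assert (0 < x * sin t ^ 2)
    by (apply Rmult_lt_0_compat; [lra | exact (pow_lt _ 2 Hsin)]).
  set (q := sqrt _) in *.
  apply Rmult_lt_reg_r with q; [exact Hs |].
  rewrite Rinv_l by lra; lra.
Qed.

Lemma ellE_pos (x : R) : 0 < x < 1 -> 0 < ellE x.
Proof.
intros Hx; pose proof PI_RGT_0.
apply RInt_gt_0; [lra | |].
- intros t _; now apply sqrt_lt_R0, one_minus_sin_sqr_pos.
- intros t _; now apply (continuous_modulus sqrt); [exact continuous_sqrt_pos |].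
Qed.

Lemma ellE_le_PI2 (x : R) : 0 < x < 1 -> ellE x <= PI / 2.
Proof.
intros Hx; pose proof PI_RGT_0.
replace (PI / 2) with (RInt (fun _ => 1) 0 (PI / 2)).
2:{ rewrite RInt_const; unfold scal; simpl; unfold mult; simpl; lra. }
apply RInt_le; [lra | | apply ex_RInt_const |].
- eexists; apply (is_RInt_modulus sqrt x continuous_sqrt_pos Hx).
- intros t _; apply Rle_trans with (sqrt 1); [| rewrite sqrt_1; lra].
  apply sqrt_le_1_alt; pose proof (sin_sqr_bounds t); nra.
Qed.

(** Dividing [1 - x <= 1 - x * sin t ^ 2] by the square root compares the integrands. The result
    yields [ellW x <= x]. *)
Lemma ellK_le_ellE (x : R) : 0 < x < 1 -> (1 - x) * ellK x <= ellE x.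
Proof.
intros Hx; pose proof PI_RGT_0.
pose proof (is_RInt_modulus (fun u => / sqrt u) x continuous_inv_sqrt Hx) as HK.
replace ((1 - x) * ellK x) with
  (RInt (fun t => (1 - x) * / sqrt (1 - x * sin t ^ 2)) 0 (PI / 2)).
2:{ apply is_RInt_unique.
    apply (is_RInt_scal (V := R_NormedModule) _ _ _ (1 - x) _ HK). }
apply RInt_le; [lra | | |].
- eexists; apply (is_RInt_scal (V := R_NormedModule) _ _ _ (1 - x) _ HK).
- eexists; apply (is_RInt_modulus sqrt x continuous_sqrt_pos Hx).
- intros t _.
  pose proof (one_minus_sin_sqr_pos x t Hx) as Hp.
  pose proof (sqrt_lt_R0 _ Hp) as Hs.
  pose proof (sqrt_sqrt _ (Rlt_le _ _ Hp)) as Hss.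
  pose proof (sin_sqr_bounds t).
  set (q := sqrt _) in *.
  apply Rmult_le_reg_r with q; [exact Hs |].
  rewrite Rmult_assoc, Rinv_l by lra; nra.
Qed.

Lemma ellK_pos (x : R) : 0 < x < 1 -> 0 < ellK x.
Proof.
intros Hx; pose proof (ellE_lt_ellK x Hx); pose proof (ellE_pos x Hx); lra.
Qed.

(* With [eps = sqrt (1 - x)], the integrand of [ellK x] is at least
   [1 / (eps + (PI / 2 - t))]. *)
Lemma ellK_unbounded (M : R) : 0 < M -> exists x, 0 < x < 1 /\ M <= ellK x.
Proof.
(* The minorant integrates to [ln (eps + PI / 2) - ln eps]; here [- ln eps = M], and the other term
   is nonnegative because [PI / 2 > 1]. *)
intros HM; set (eps := exp (- M)).
assert (He : 0 < eps < 1).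
{ split; [apply exp_pos |]; rewrite <- exp_0; apply exp_increasing; lra. }
assert (Hx : 0 < 1 - eps ^ 2 < 1) by (simpl; nra).
exists (1 - eps ^ 2); split; [exact Hx |].
pose proof PI2_1; pose proof PI_RGT_0.
set (F := fun t => - ln (eps + (PI / 2 - t))).
set (f := fun t => / (eps + (PI / 2 - t))).
assert (Hr : forall t, Rmin 0 (PI / 2) <= t <= Rmax 0 (PI / 2) ->
                       0 <= t <= PI / 2).
{ intros t; rewrite Rmin_left, Rmax_right by lra; easy. }
assert (HF : is_RInt f 0 (PI / 2) (F (PI / 2) - F 0)).
{ apply (is_RInt_derive F f); intros t Ht; apply Hr in Ht; unfold F, f.
  - auto_derive; [lra |]; field; lra.
  - apply (ex_derive_continuous (fun t => / (eps + (PI / 2 - t)))).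
    auto_derive; lra. }
apply Rle_trans with (F (PI / 2) - F 0).
- unfold F.
  replace (eps + (PI / 2 - PI / 2)) with eps by ring.
  unfold eps at 1; rewrite ln_exp.
  assert (0 <= ln (eps + (PI / 2 - 0))).
  { apply Rle_trans with (ln 1); [rewrite ln_1; lra | apply ln_le; lra]. }
  lra.
- rewrite <- (is_RInt_unique _ _ _ _ HF).
  apply RInt_le; [lra | eexists; exact HF | |].
  { eexists; apply (is_RInt_modulus (fun u => / sqrt u) _ continuous_inv_sqrt Hx). }
  intros t Ht; unfold f.
  pose proof (one_minus_sin_sqr_pos _ t Hx) as Hp.
  apply Rinv_le_contravar; [now apply sqrt_lt_R0 |].
  rewrite <- (sqrt_pow2 (eps + (PI / 2 - t))) by lra.
  apply sqrt_le_1_alt.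
  (* The radicand equals [cos t ^ 2 + eps ^ 2 * sin t ^ 2], at most [(PI / 2 - t) ^ 2 + eps ^ 2],
     hence at most the square of the sum. *)
  assert (Hc : 0 <= cos t) by (apply cos_ge_0; lra).
  assert (cos t <= PI / 2 - t) by (rewrite cos_sin; left;
    replace (PI / 2 + t) with (PI - (PI / 2 - t)) by field;
    rewrite sin_PI_x; apply sin_lt_x; lra).
  pose proof (sin2_cos2 t) as Hsc; unfold Rsqr in Hsc.
  assert (cos t * cos t <= (PI / 2 - t) * (PI / 2 - t)) by nra.
  pose proof (sin_sqr_bounds t).
  assert (eps ^ 2 * sin t ^ 2 <= eps ^ 2) by nra.
  nra.
Qed.

(** * The Riccati equation *)

Definition ellW (x : R) : R := 1 - ellE x / ellK x.

Lemma ellW_bounds (x : R) : 0 < x < 1 -> 0 < ellW x <= x.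
Proof.
intros Hx; unfold ellW.
pose proof (ellE_lt_ellK x Hx); pose proof (ellK_pos x Hx).
pose proof (ellK_le_ellE x Hx).
assert (HE : ellE x = ellE x / ellK x * ellK x) by (field; lra).
set (u := ellE x / ellK x) in *.
split; nra.
Qed.

Lemma is_derive_ellW (x : R) : 0 < x < 1 ->
  is_derive ellW x ((x - 2 * x * ellW x + ellW x ^ 2) / (2 * x * (1 - x))).
Proof.
intros Hx; pose proof (ellK_pos x Hx).
pose proof (is_derive_div _ _ _ _ _ (is_derive_ellE x Hx) (is_derive_ellK x Hx))
  as Hd.
unfold ellW.
evar_last.
{ apply (is_derive_minus (fun _ => 1) (fun x => ellE x / ellK x));
    [apply is_derive_const | apply Hd; lra]. }
unfold minus, plus, opp, zero; simpl; field; lra.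
Qed.

(** Defect of [T] in the Riccati equation with denominators cleared; it vanishes when [T] and [dT]
    are [ellW] and its derivative. *)
Definition residual (x T dT : R) : R :=
  x - 2 * x * T + T ^ 2 - 2 * x * (1 - x) * dT.

(** The quadratic and linear terms of the two equations differ by a multiple of [ellW x - T x],
    which factors out. *)
Lemma is_derive_ellW_minus (T dT : R -> R) (x : R) :
  0 < x < 1 -> is_derive T x (dT x) ->
  is_derive (fun x => ellW x - T x) x
    (((ellW x + T x - 2 * x) * (ellW x - T x) + residual x (T x) (dT x))
     / (2 * x * (1 - x))).
Proof.
intros Hx HT; evar_last.
{ apply (is_derive_minus ellW T); [now apply is_derive_ellW | exact HT]. }
unfold minus, plus, opp, residual; simpl; field; lra.
Qed.

(* [ellK ^ -2] solves the linearisation of the Riccati equation at [ellW]. *)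
Lemma is_derive_ellK2_ellW_minus (T dT : R -> R) (x : R) :
  0 < x < 1 -> is_derive T x (dT x) ->
  is_derive (fun x => ellK x ^ 2 * (ellW x - T x)) x
    (ellK x ^ 2 / (2 * x * (1 - x))
     * (residual x (T x) (dT x) - (ellW x - T x) ^ 2)).
Proof.
intros Hx HT; pose proof (ellK_pos x Hx); evar_last.
{ apply (is_derive_mult (fun x => ellK x ^ 2) (fun x => ellW x - T x)).
  - apply (is_derive_pow ellK 2); now apply is_derive_ellK.
  - exact (is_derive_ellW_minus T dT x Hx HT).
  - exact Rmult_comm. }
unfold plus, mult, residual; simpl.
(* The logarithmic derivative of [ellK ^ 2] is thus [(2 * x - 2 * ellW x) / (2 * x * (1 - x))],
   which turns the factor [ellW x + T x - 2 * x] into [- (ellW x - T x)]. *)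
replace (ellE x) with ((1 - ellW x) * ellK x)
  by (unfold ellW; field; lra).
field; lra.
Qed.

(** * Taylor truncations and their remainders *)

(* Encodes that [p] is the Taylor polynomial of degree [n] of [ellW] at [0] and
   [c] its next coefficient.  As all coefficients of [ellW] are nonnegative,
   [p] and [A] are nondecreasing. *)
Record truncation (n : nat) (c : R) (p dp A : R -> R) : Prop := {
  tr_derive : forall x, 0 < x < 1 -> is_derive p x (dp x);
  tr_residual : forall x, 0 < x < 1 ->
    residual x (p x) (dp x) = x ^ S n * (2 * INR (S n) * c + x * A x);
  tr_poly : forall x, 0 < x < 1 -> 0 <= p x <= x;
  tr_poly_incr : forall x z, 0 < x -> x <= z -> z < 1 -> p x <= p z;
  tr_rem : forall x, 0 < x < 1 -> 0 <= A x <= 1;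
  tr_rem_incr : forall x z, 0 < x -> x <= z -> z < 1 -> A x <= A z;
  tr_coef : 0 <= c <= 1 }.

Definition remainder (n : nat) (p : R -> R) (x : R) : R :=
  (ellW x - p x) / x ^ S n.

(** [2 * x * (1 - x)] times the derivative of the remainder, with its value replaced by an
    independent [g] that can stay frozen while [x] varies. *)
Definition remainder_field (n : nat) (c : R) (p A : R -> R) (x g : R) : R :=
  2 * INR (S n) * (c - g) + x * A x + 2 * INR n * x * g + 2 * p x * g
  + x ^ S n * g ^ 2.

Lemma residual_perturb (n : nat) (c : R) (p dp A : R -> R) (x g : R) :
  truncation n c p dp A -> 0 < x < 1 ->
  residual x (p x + g * x ^ S n) (dp x + g * (INR (S n) * x ^ n)) =
  x ^ S n * remainder_field n c p A x g.
Proof.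
intros Ht Hx; pose proof (tr_residual _ _ _ _ _ Ht x Hx) as Hr.
unfold remainder_field.
replace (residual x (p x + g * x ^ S n) (dp x + g * (INR (S n) * x ^ n))) with
  (residual x (p x) (dp x) + x ^ S n *
    (- 2 * x * g + 2 * p x * g - 2 * (1 - x) * g * INR (S n) + x ^ S n * g ^ 2))
  by (unfold residual; simpl; ring).
rewrite Hr, S_INR; ring.
Qed.

Lemma is_derive_perturb (n : nat) (c : R) (p dp A : R -> R) (x g : R) :
  truncation n c p dp A -> 0 < x < 1 ->
  is_derive (fun x => p x + g * x ^ S n) x (dp x + g * (INR (S n) * x ^ n)).
Proof.
intros Ht Hx.
apply (is_derive_plus p (fun x => g * x ^ S n)).
- now apply (tr_derive _ _ _ _ _ Ht).
- apply (is_derive_scal (fun x => x ^ S n)).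
  evar_last; [apply (is_derive_pow (fun x => x) (S n)), is_derive_id |].
  change (INR (S n) * 1 * x ^ n = INR (S n) * x ^ n); ring.
Qed.

Lemma ellW_remainder (n : nat) (p : R -> R) (x : R) :
  0 < x -> ellW x = p x + remainder n p x * x ^ S n.
Proof.
intros Hx; unfold remainder; field; apply pow_nonzero; lra.
Qed.

(** With [g] frozen at the value at [x], the numerator [ellW z - (p z + g * z ^ S n)] vanishes at
    [z = x], so the quotient rule keeps only its derivative, which there comes from the residual of
    the perturbed polynomial. *)
Lemma is_derive_remainder (n : nat) (c : R) (p dp A : R -> R) (x : R) :
  truncation n c p dp A -> 0 < x < 1 ->
  is_derive (remainder n p) x
    (remainder_field n c p A x (remainder n p x) / (2 * x * (1 - x))).
Proof.
intros Ht Hx.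
assert (Hn : x ^ S n <> 0) by (apply pow_nonzero; lra).
set (g := remainder n p x).
apply (is_derive_ext_loc
  (fun z => g + (ellW z - (p z + g * z ^ S n)) / z ^ S n)).
{ apply locally_unit_interval with (2 := Hx); intros y Hy.
  change (g + (ellW y - (p y + g * y ^ S n)) / y ^ S n = remainder n p y).
  unfold remainder; field; apply (pow_nonzero y (S n)); lra. }
assert (H0 : ellW x - (p x + g * x ^ S n) = 0).
{ rewrite (ellW_remainder n p x) by lra; fold g; ring. }
evar_last.
{ apply (is_derive_plus (fun _ => g)
    (fun z => (ellW z - (p z + g * z ^ S n)) / z ^ S n));
    [apply is_derive_const |].
  apply is_derive_div; [| | exact Hn].
  - apply (is_derive_ellW_minus (fun z => p z + g * z ^ S n)
             (fun z => dp z + g * (INR (S n) * z ^ n)) x Hx).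
    exact (is_derive_perturb _ _ _ _ _ _ g Ht Hx).
  - apply (is_derive_pow (fun x => x) (S n)), is_derive_id. }
rewrite (residual_perturb _ _ _ _ _ _ g Ht Hx).
unfold plus, zero; simpl.
change (x * x ^ n) with (x ^ S n); rewrite H0.
match goal with |- @eq _ ?a ?b => change (@eq R a b) end.
field; repeat split; try lra; apply pow_nonzero; lra.
Qed.

(** For fixed [g > 0] every term is nondecreasing in [x], and [x ^ S n * g ^ 2] strictly
    increases. *)
Lemma remainder_field_lt (n : nat) (c : R) (p dp A : R -> R) (x z g : R) :
  truncation n c p dp A -> 0 < g -> 0 < x -> x < z -> z < 1 ->
  remainder_field n c p A x g < remainder_field n c p A z g.
Proof.
intros Ht Hg H0x Hxz Hz1; unfold remainder_field.
pose proof (tr_poly_incr _ _ _ _ _ Ht x z H0x (Rlt_le _ _ Hxz) Hz1).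
pose proof (tr_rem_incr _ _ _ _ _ Ht x z H0x (Rlt_le _ _ Hxz) Hz1).
pose proof (tr_rem _ _ _ _ _ Ht x ltac:(lra)).
assert (x * A x <= z * A z) by (apply Rmult_le_compat; lra).
assert (2 * INR n * x * g <= 2 * INR n * z * g).
{ apply Rmult_le_compat_r; [lra |]; apply Rmult_le_compat_l; [| lra].
  pose proof (pos_INR n); lra. }
assert (2 * p x * g <= 2 * p z * g) by (apply Rmult_le_compat_r; lra).
assert (x ^ S n * g ^ 2 < z ^ S n * g ^ 2).
{ apply Rmult_lt_compat_r; [now apply pow_lt |].
  pose proof (pow_lt x n H0x); pose proof (pow_incr x z n ltac:(lra)).
  simpl; nra. }
lra.
Qed.

(** * Monotonicity of the remainder *)

Definition pos_bounded (y : R -> R) : Prop :=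
  (forall x, 0 < x < 1 -> 0 < y x) /\
  exists B, forall x, 0 < x < / 2 -> y x <= B.

(** Stands in for passages to the limit: an error of order [x] is brought below a given gap [d]. *)
Lemma linear_small (C d a : R) :
  0 <= C -> 0 < d -> 0 < a -> exists x, 0 < x < a /\ C * x < d.
Proof.
intros HC Hd Ha.
assert (Hq : 0 < d / (C + 1)) by (apply Rdiv_lt_0_compat; lra).
exists (Rmin a (d / (C + 1)) / 2).
assert (Hm : 0 < Rmin a (d / (C + 1))) by now apply Rmin_glb_lt.
pose proof (Rmin_l a (d / (C + 1))); pose proof (Rmin_r a (d / (C + 1))).
split; [lra |].
replace d with (C * (d / (C + 1)) + d / (C + 1)) at 2 by (field; lra).
nra.
Qed.

Lemma mean_value (f df : R -> R) (a b : R) :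
  0 < a -> a < b -> b < 1 ->
  (forall x, 0 < x < 1 -> is_derive f x (df x)) ->
  exists c, a < c < b /\ f b - f a = df c * (b - a).
Proof.
intros Ha Hab Hb Hf.
destruct (MVT_cor2 f df a b Hab) as [c [Hc Hi]].
- intros c Hc; apply is_derive_Reals, Hf; lra.
- now exists c.
Qed.

Lemma ellK_le_4 (x : R) : 0 < x < / 2 -> ellK x <= 4.
Proof.
intros Hx; pose proof (ellK_le_ellE x ltac:(lra)).
pose proof (ellE_le_PI2 x ltac:(lra)); pose proof PI_4.
pose proof (ellK_pos x ltac:(lra)); nra.
Qed.

(* If the derivative of the remainder were nonpositive at [x], the truncation
   perturbed to agree with [ellW] at [x] would have negative residual on
   [(0, x)], so [ellK ^ 2] times the error would decrease strictly from its
   limit [0] at the origin to [0] at [x]. *)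
Lemma remainder_field_pos (n : nat) (c : R) (p dp A : R -> R) (x : R) :
  truncation n c p dp A -> pos_bounded (remainder n p) -> 0 < x < 1 ->
  0 < remainder_field n c p A x (remainder n p x).
Proof.
intros Ht [Hpos [B HB]] Hx; apply Rnot_le_lt; intros Hneg.
set (g := remainder n p x) in *.
assert (Hg : 0 < g) by now apply Hpos.
set (N := fun z => ellK z ^ 2 * (ellW z - (p z + g * z ^ S n))).
set (dN := fun z => ellK z ^ 2 / (2 * z * (1 - z)) *
  (residual z (p z + g * z ^ S n) (dp z + g * (INR (S n) * z ^ n))
   - (ellW z - (p z + g * z ^ S n)) ^ 2)).
assert (HN : forall z, 0 < z < 1 -> is_derive N z (dN z)).
{ intros z Hz.
  apply (is_derive_ellK2_ellW_minus (fun z => p z + g * z ^ S n)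
           (fun z => dp z + g * (INR (S n) * z ^ n)) z Hz).
  exact (is_derive_perturb _ _ _ _ _ z g Ht Hz). }
(* The field with [g] frozen is at most [0] at [x] and strictly increasing, so it is negative on
   [(0, x)]. *)
assert (HdN : forall z, 0 < z < x -> dN z < 0).
{ intros z Hz; unfold dN.
  rewrite (residual_perturb _ _ _ _ _ z g Ht) by lra.
  pose proof (remainder_field_lt _ _ _ _ _ z x g Ht Hg ltac:(lra) ltac:(lra)
                ltac:(lra)).
  pose proof (pow_lt z (S n) ltac:(lra)).
  pose proof (pow2_ge_0 (ellW z - (p z + g * z ^ S n))).
  pose proof (pow_lt _ 2 (ellK_pos z ltac:(lra))).
  assert (0 < ellK z ^ 2 / (2 * z * (1 - z))).
  { apply Rdiv_lt_0_compat; [easy |]; apply Rmult_lt_0_compat; lra. }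
  set (Phi := remainder_field n c p A z g) in *.
  assert (z ^ S n * Phi < 0) by (set (u := z ^ S n) in *; nra).
  set (q := ellK z ^ 2 / _) in *; nra. }
assert (Hdec : forall a b, 0 < a -> a < b -> b <= x -> N b < N a).
{ intros a b Ha Hab Hb.
  destruct (mean_value N dN a b Ha Hab ltac:(lra) HN) as [z [Hz Heq]].
  pose proof (HdN z ltac:(lra)); nra. }
assert (Hx0 : N x = 0).
{ unfold N; rewrite (ellW_remainder n p x) by lra; fold g; ring. }
set (a := Rmin x (/ 2) / 2).
assert (Ha : 0 < a /\ a < x /\ a < / 2).
{ assert (0 < Rmin x (/ 2)) by (apply Rmin_glb_lt; lra).
  pose proof (Rmin_l x (/ 2)); pose proof (Rmin_r x (/ 2)); unfold a; lra. }
pose proof (Hdec a x ltac:(lra) ltac:(lra) ltac:(lra)) as HNa.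
pose proof (Hpos a ltac:(lra)); pose proof (HB a ltac:(lra)).
(* Near the origin [ellK ^ 2 <= 16] and the remainder is at most [B], so [N e <= 16 * B * e < N a],
   although [N] decreases. *)
destruct (linear_small (16 * B) (N a) a ltac:(lra) ltac:(lra) ltac:(lra))
  as [e [He1 He2]].
pose proof (Hdec e a ltac:(lra) ltac:(lra) ltac:(lra)) as HNe.
assert (N e <= 16 * B * e); [| lra].
unfold N; rewrite (ellW_remainder n p e) by lra.
replace (p e + remainder n p e * e ^ S n - (p e + g * e ^ S n)) with
  ((remainder n p e - g) * e ^ S n) by ring.
pose proof (Hpos e ltac:(lra)); pose proof (HB e ltac:(lra)).
pose proof (ellK_le_4 e ltac:(lra)); pose proof (ellK_pos e ltac:(lra)).
assert (ellK e ^ 2 <= 16) by nra.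
pose proof (pow2_ge_0 (ellK e)).
assert (0 <= e ^ n <= 1).
{ split; [apply pow_le; lra |].
  rewrite <- (pow1 n); apply pow_incr; lra. }
assert (0 <= e ^ S n <= e) by (simpl; nra).
apply Rle_trans with (ellK e ^ 2 * (B * e)).
- apply Rmult_le_compat_l; [easy |].
  apply Rle_trans with (B * e ^ S n); [apply Rmult_le_compat_r; lra |].
  apply Rmult_le_compat_l; lra.
- rewrite Rmult_assoc; apply Rmult_le_compat_r; [| easy].
  apply Rmult_le_pos; lra.
Qed.

Lemma remainder_increasing (n : nat) (c : R) (p dp A : R -> R) (x z : R) :
  truncation n c p dp A -> pos_bounded (remainder n p) ->
  0 < x -> x < z -> z < 1 -> remainder n p x < remainder n p z.
Proof.
intros Ht Hy Hx Hxz Hz.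
destruct (mean_value (remainder n p)
  (fun x => remainder_field n c p A x (remainder n p x) / (2 * x * (1 - x)))
  x z Hx Hxz Hz) as [e [He Heq]].
- intros e He; exact (is_derive_remainder _ _ _ _ _ e Ht He).
- assert (0 < remainder_field n c p A e (remainder n p e)
                / (2 * e * (1 - e))).
  { apply Rdiv_lt_0_compat.
    - apply (remainder_field_pos _ _ _ dp); [exact Ht | exact Hy | lra].
    - apply Rmult_lt_0_compat; lra. }
  cbv beta in Heq; nra.
Qed.

(** * Behaviour of the remainder at the origin *)

(** Mean value theorem between [x] and a point [e] so close to [0] that the linear bound makes [M e]
    negligible. *)
Lemma pow_error (M dM : R -> R) (n : nat) (B C x : R) :
  0 <= B -> 0 <= C ->
  (forall z, 0 < z < 1 -> is_derive M z (dM z)) ->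
  (forall z, 0 < z < / 2 -> Rabs (dM z) <= C * z ^ n) ->
  (forall z, 0 < z < / 2 -> Rabs (M z) <= B * z) ->
  0 < x < / 2 -> Rabs (M x) <= C * x ^ S n.
Proof.
intros HB HC HM HdM HM0 Hx; apply Rnot_lt_le; intros Hlt.
destruct (linear_small B (Rabs (M x) - C * x ^ S n) x HB ltac:(lra)
  ltac:(lra)) as [e [He1 He2]].
destruct (mean_value M dM e x ltac:(lra) ltac:(lra) ltac:(lra) HM)
  as [z [Hz Heq]].
pose proof (HdM z ltac:(lra)); pose proof (HM0 e ltac:(lra)).
pose proof (pow_incr z x n ltac:(lra)); pose proof (pow_le z n ltac:(lra)).
assert (Rabs (M x - M e) <= C * x ^ S n).
{ rewrite Heq, Rabs_mult, (Rabs_pos_eq (x - e)) by lra.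
  pose proof (Rabs_pos (dM z)).
  replace (C * x ^ S n) with ((C * x ^ n) * x) by (simpl; ring).
  apply Rmult_le_compat; try lra.
  apply Rle_trans with (C * z ^ n); [easy | apply Rmult_le_compat_l; lra]. }
pose proof (Rabs_triang (M x - M e) (M e)) as Htri.
replace (M x - M e + M e) with (M x) in Htri by ring.
lra.
Qed.

(** Adding [c * x ^ S n] to [p] cancels the leading term of the residual. The new error has a
    derivative of order [S n], hence is itself of order [S (S n)], and division by [x ^ S n] leaves
    a linear bound. *)
Lemma remainder_near_0 (n : nat) (c : R) (p dp A : R -> R) :
  truncation n c p dp A -> pos_bounded (remainder n p) ->
  exists C, 0 <= C /\
    forall x, 0 < x < / 2 -> Rabs (remainder n p x - c) <= C * x.
Proof.
intros Ht [Hpos [B HB]].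
pose proof (tr_coef _ _ _ _ _ Ht) as Hc.
pose proof (pos_INR n) as Hn.
assert (HB0 : 0 < B).
{ pose proof (Hpos (/ 4) ltac:(lra)); pose proof (HB (/ 4) ltac:(lra)); lra. }
assert (Habs : forall x, 0 < x < / 2 -> Rabs (remainder n p x - c) <= B + 1).
{ intros x Hx; pose proof (Hpos x ltac:(lra)); pose proof (HB x Hx).
  apply Rabs_le; lra. }
(* Per unit of [z], [2 * (B + 1)] bounds [L * (remainder n p z - c)] and [2 * INR n + 4] bounds the
   field at [c]; the denominator [2 * z * (1 - z)] is at least [z] for [z < / 2]. *)
set (C := 2 * (B + 1) + 2 * INR n + 4).
exists C; split; [unfold C; lra |]; intros x Hx.
set (M := fun z => ellW z - (p z + c * z ^ S n)).
assert (HMr : forall z, 0 < z -> M z = (remainder n p z - c) * z ^ S n).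
{ intros z Hz; unfold M; rewrite (ellW_remainder n p z Hz); ring. }
set (dM := fun z =>
  ((ellW z + (p z + c * z ^ S n) - 2 * z) * (ellW z - (p z + c * z ^ S n))
   + residual z (p z + c * z ^ S n) (dp z + c * (INR (S n) * z ^ n)))
  / (2 * z * (1 - z))).
assert (Hpw : forall z, 0 < z < / 2 -> 0 <= z ^ n <= 1).
{ intros z Hz; split; [apply pow_le; lra |].
  rewrite <- (pow1 n); apply pow_incr; lra. }
assert (HMx : Rabs (M x) <= C * x ^ S (S n)).
{ apply (pow_error M dM (S n) (B + 1) C); try lra.
  - unfold C; lra.
  - intros z Hz.
    apply (is_derive_ellW_minus (fun z => p z + c * z ^ S n)
             (fun z => dp z + c * (INR (S n) * z ^ n)) z Hz).
    exact (is_derive_perturb _ _ _ _ _ z c Ht Hz).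
  - intros z Hz; unfold dM.
    rewrite (residual_perturb _ _ _ _ _ z c Ht) by lra.
    fold (M z); rewrite (HMr z) by lra.
    pose proof (Hpw z Hz) as Hzn.
    pose proof (ellW_bounds z ltac:(lra)).
    pose proof (tr_poly _ _ _ _ _ Ht z ltac:(lra)).
    pose proof (tr_rem _ _ _ _ _ Ht z ltac:(lra)).
    assert (Hz1 : 0 <= z ^ S n <= z) by (simpl; nra).
    assert (Hz0 : 0 < z ^ S n) by (apply pow_lt; lra).
    set (u := z ^ S n) in *.
    set (L := ellW z + (p z + c * u) - 2 * z).
    assert (0 <= c * u <= z) by nra.
    assert (HL : Rabs L <= 2 * z) by (apply Rabs_le; unfold L; lra).
    assert (HPhi : 0 <= remainder_field n c p A z c
                     <= (2 * INR n + 4) * z).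
    { unfold remainder_field; fold u.
      rewrite Rminus_diag, Rmult_0_r, Rplus_0_l.
      assert (0 <= z * A z <= z) by nra.
      assert (0 <= 2 * INR n * z) by nra.
      assert (0 <= 2 * INR n * z * c <= 2 * INR n * z) by nra.
      assert (0 <= 2 * p z * c <= 2 * z) by nra.
      assert (0 <= c ^ 2 <= 1) by nra.
      assert (0 <= u * c ^ 2 <= z) by nra.
      lra. }
    set (Phi := remainder_field n c p A z c) in *.
    replace (L * ((remainder n p z - c) * u) + u * Phi) with
      (u * (L * (remainder n p z - c) + Phi)) by ring.
    unfold Rdiv; rewrite !Rabs_mult.
    rewrite (Rabs_pos_eq u), (Rabs_pos_eq (/ _)).
    2:{ left; apply Rinv_0_lt_compat, Rmult_lt_0_compat; lra. }
    2: lra.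
    assert (Hin : Rabs (L * (remainder n p z - c) + Phi) <= C * z).
    { eapply Rle_trans; [apply Rabs_triang |].
      rewrite Rabs_mult, (Rabs_pos_eq Phi) by lra.
      pose proof (Rmult_le_compat _ _ _ _ (Rabs_pos L)
        (Rabs_pos (remainder n p z - c)) HL (Habs z Hz)).
      unfold C; lra. }
    apply Rle_div_l; [apply Rmult_lt_0_compat; lra |].
    apply Rle_trans with (u * (C * z)).
    + apply Rmult_le_compat_l; lra.
    + assert (0 <= C * u) by (apply Rmult_le_pos; unfold C; lra).
      set (Cu := C * u) in *.
      replace (u * (C * z)) with (Cu * z) by (unfold Cu; ring).
      apply Rmult_le_compat_l; nra.
  - intros z Hz; rewrite HMr, Rabs_mult by lra.
    pose proof (Hpw z Hz).
    assert (0 <= z ^ S n <= z) by (simpl; nra).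
    rewrite (Rabs_pos_eq (z ^ S n)) by lra.
    apply Rmult_le_compat; try lra; [apply Rabs_pos | now apply Habs]. }
rewrite HMr, Rabs_mult in HMx by lra.
assert (Hp : 0 < x ^ S n) by (apply pow_lt; lra).
rewrite (Rabs_pos_eq (x ^ S n)) in HMx by lra.
apply Rmult_le_reg_r with (x ^ S n); [exact Hp |].
simpl in *; lra.
Qed.

(** The remainder increases from its limit [c]. A value at most [c] at [x] would make the value at
    [x / 2] smaller still, and those further left could not approach [c]. *)
Lemma remainder_gt (n : nat) (c : R) (p dp A : R -> R) (x : R) :
  truncation n c p dp A -> pos_bounded (remainder n p) -> 0 < x < 1 ->
  c < remainder n p x.
Proof.
intros Ht Hy Hx; apply Rnot_le_lt; intros Hle.
destruct (remainder_near_0 _ _ _ _ _ Ht Hy) as [C [HC Hnear]].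
pose proof (remainder_increasing _ _ _ _ _ (x / 2) x Ht Hy ltac:(lra)
  ltac:(lra) ltac:(lra)) as H1.
destruct (linear_small C (c - remainder n p (x / 2)) (x / 2) HC ltac:(lra)
  ltac:(lra)) as [e [He1 He2]].
pose proof (remainder_increasing _ _ _ _ _ e (x / 2) Ht Hy ltac:(lra)
  ltac:(lra) ltac:(lra)) as H2.
pose proof (Rabs_le_between' (remainder n p e) c (C * e)) as [H3 _].
specialize (H3 (Hnear e ltac:(lra))); lra.
Qed.

(** Induction step: the next remainder is [(remainder n p x - c) / x], positive by [remainder_gt]
    and bounded by [remainder_near_0]. *)
Lemma pos_bounded_next (n : nat) (c : R) (p q dp A : R -> R) :
  truncation n c p dp A -> pos_bounded (remainder n p) ->
  (forall x, q x = p x + c * x ^ S n) -> pos_bounded (remainder (S n) q).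
Proof.
intros Ht Hy Hq.
assert (Heq : forall x, 0 < x ->
  remainder (S n) q x = (remainder n p x - c) / x).
{ intros x Hx; unfold remainder; rewrite Hq.
  change (x ^ S (S n)) with (x * x ^ S n).
  pose proof (pow_lt x (S n) Hx); field; lra. }
split.
- intros x Hx; rewrite Heq by lra.
  pose proof (remainder_gt _ _ _ _ _ x Ht Hy Hx).
  apply Rdiv_lt_0_compat; lra.
- destruct (remainder_near_0 _ _ _ _ _ Ht Hy) as [C [HC Hnear]].
  exists C; intros x Hx; rewrite Heq by lra.
  apply Rle_div_l; [lra |].
  pose proof (Hnear x Hx); pose proof (Rle_abs (remainder n p x - c)); lra.
Qed.

(** * The truncations of degrees 0 to 3 *)

Ltac solve_truncation :=
  split; [ intros x Hx; auto_derive; [easy | simpl; field]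
         | intros x Hx; unfold residual; simpl; field
         | intros; simpl; nra .. ].

Lemma truncation_0 : truncation 0 (1 / 2) (fun _ => 0) (fun _ => 0) (fun _ => 0).
Proof. solve_truncation. Qed.

Lemma truncation_1 :
  truncation 1 (1 / 16) (fun x => x / 2) (fun _ => 1 / 2) (fun _ => 0).
Proof. solve_truncation. Qed.

(** Beyond degree [S n] the residual contains only terms of [p ^ 2], collected in [A]; here
    [1 / 256] is the square of [1 / 16]. *)
Lemma truncation_2 :
  truncation 2 (1 / 32) (fun x => x / 2 + x ^ 2 / 16) (fun x => 1 / 2 + x / 8)
    (fun _ => 1 / 256).
Proof. solve_truncation. Qed.

Definition taylor3 (x : R) : R := x / 2 + x ^ 2 / 16 + x ^ 3 / 32.

Lemma taylor3_incr (x z : R) : 0 < x -> x <= z -> z < 1 -> taylor3 x <= taylor3 z.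
Proof.
intros Hx Hxz Hz; unfold taylor3.
pose proof (pow_incr x z 2 ltac:(lra)); pose proof (pow_incr x z 3 ltac:(lra)).
lra.
Qed.

(** The coefficient recursion reads [8 * c = 4 / 32 + 1 / 32 + 1 / 256], whence [c = 41 / 2048]. *)
Lemma truncation_3 :
  truncation 3 (41 / 2048) taylor3 (fun x => 1 / 2 + x / 8 + 3 * x ^ 2 / 32)
    (fun x => 1 / 256 + x / 1024).
Proof.
unfold taylor3; split.
- intros x Hx; auto_derive; [easy | simpl; field].
- intros x Hx; unfold residual; simpl; field.
- intros x Hx; assert (0 <= x ^ 2 <= x) by (simpl; nra).
  assert (0 <= x ^ 3 <= x) by (replace (x ^ 3) with (x * x ^ 2) by ring; nra).
  lra.
- exact taylor3_incr.
- intros; lra.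
- intros; lra.
- lra.
Qed.

Lemma pos_bounded_0 : pos_bounded (remainder 0 (fun _ => 0)).
Proof.
assert (H : forall x, 0 < x < 1 -> 0 < remainder 0 (fun _ => 0) x <= 1).
{ intros x Hx; pose proof (ellW_bounds x Hx).
  unfold remainder; rewrite pow_1, Rminus_0_r.
  split; [apply Rdiv_lt_0_compat; lra | apply Rle_div_l; lra]. }
split.
- intros x Hx; now apply H.
- exists 1; intros x Hx; apply H; lra.
Qed.

Lemma pos_bounded_3 : pos_bounded (remainder 3 taylor3).
Proof.
apply (pos_bounded_next _ _ _ _ _ _ truncation_2).
2:{ intros x; unfold taylor3; simpl; field. }
apply (pos_bounded_next _ _ _ _ _ _ truncation_1).
2:{ intros x; simpl; field. }
apply (pos_bounded_next _ _ _ _ _ _ truncation_0 pos_bounded_0).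
intros x; simpl; field.
Qed.

(** * Range of the remainder of [taylor3] *)

Lemma remainder3_gt (x : R) : 0 < x < 1 -> 41 / 2048 < remainder 3 taylor3 x.
Proof. exact (remainder_gt _ _ _ _ _ x truncation_3 pos_bounded_3). Qed.

Lemma remainder3_increasing (x z : R) : 0 < x -> x < z -> z < 1 ->
  remainder 3 taylor3 x < remainder 3 taylor3 z.
Proof. exact (remainder_increasing _ _ _ _ _ x z truncation_3 pos_bounded_3). Qed.

(** [ellW] stays below [1] while [taylor3] tends to [19 / 32] at [1]. A remainder above [13 / 32]
    would persist up to [1] by monotonicity and push their sum past [1]. *)
Lemma remainder3_lt (x : R) : 0 < x < 1 -> remainder 3 taylor3 x < 13 / 32.
Proof.
assert (Hle : forall x, 0 < x < 1 -> remainder 3 taylor3 x <= 13 / 32).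
{ intros z Hz; apply Rnot_lt_le; intros Hlt.
  set (g := remainder 3 taylor3 z) in *.
  (* Between [1] and [1 - e], [taylor3] drops by at most [e] and [g * y ^ 4] by at most
     [4 * g * e]. *)
  destruct (linear_small (4 * g + 1) (g - 13 / 32) (1 - z) ltac:(lra)
    ltac:(lra) ltac:(lra)) as [e [He1 He2]].
  set (y := 1 - e).
  assert (Hy : z < y < 1) by (unfold y; lra).
  pose proof (remainder3_increasing z y ltac:(lra) ltac:(lra) ltac:(lra)) as Hg.
  fold g in Hg.
  pose proof (ellW_remainder 3 taylor3 y ltac:(lra)) as Hw.
  pose proof (ellW_bounds y ltac:(lra)).
  assert (Hy2 : 1 - 2 * e <= y ^ 2) by (unfold y; nra).
  assert (Hy4 : 1 - 4 * e <= y ^ 4).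
  { replace (y ^ 4) with (y ^ 2 * y ^ 2) by ring.
    pose proof (pow2_ge_0 (y ^ 2 - 1)); nra. }
  assert (Hp : 19 / 32 - e <= taylor3 y).
  { unfold taylor3.
    assert (1 - 3 * e <= y ^ 3)
      by (replace (y ^ 3) with (y * y ^ 2) by ring; unfold y in *; nra).
    unfold y at 1; lra. }
  assert (g * y ^ 4 <= remainder 3 taylor3 y * y ^ 4).
  { apply Rmult_le_compat_r; [apply pow_le |]; lra. }
  assert (g * (1 - 4 * e) <= g * y ^ 4) by (apply Rmult_le_compat_l; lra).
  lra. }
intros Hx.
pose proof (remainder3_increasing x ((x + 1) / 2) ltac:(lra) ltac:(lra)
  ltac:(lra)).
pose proof (Hle ((x + 1) / 2) ltac:(lra)); lra.
Qed.

(** As [ellE <= PI / 2], a value of [ellK] beyond [PI / d] forces [ellW > 1 - d]; subtracting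
    [taylor3 x <= 19 / 32] leaves more than [13 / 32 - d = y], and [x ^ 4 <= 1]. *)
Lemma remainder3_near_1 (y : R) :
  y < 13 / 32 -> exists x, 0 < x < 1 /\ y < remainder 3 taylor3 x.
Proof.
intros Hy.
set (d := 13 / 32 - y).
assert (Hd : 0 < d) by (unfold d; lra).
pose proof PI_RGT_0.
destruct (ellK_unbounded (PI / d)) as [x [Hx HK]].
{ apply Rdiv_lt_0_compat; lra. }
exists x; split; [exact Hx |].
pose proof (ellE_le_PI2 x Hx); pose proof (ellK_pos x Hx) as HKp.
assert (Hu : ellE x / ellK x < d).
{ apply Rlt_div_l; [exact HKp |].
  apply Rle_lt_trans with (PI / 2); [easy |].
  apply Rlt_le_trans with (d * (PI / d)).
  - replace (d * (PI / d)) with PI by (field; lra); lra.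
  - apply Rmult_le_compat_l; lra. }
pose proof (remainder3_gt x Hx) as Hgt.
pose proof (ellW_remainder 3 taylor3 x ltac:(lra)) as Hw.
unfold ellW in Hw.
assert (taylor3 x <= 19 / 32).
{ unfold taylor3.
  pose proof (pow_incr x 1 2 ltac:(lra)); pose proof (pow_incr x 1 3 ltac:(lra)).
  rewrite pow1 in *; lra. }
assert (x ^ 4 <= 1) by (rewrite <- (pow1 4); apply pow_incr; lra).
assert (remainder 3 taylor3 x * x ^ 4 <= remainder 3 taylor3 x * 1)
  by (apply Rmult_le_compat_l; lra).
unfold d in *; lra.
Qed.

Lemma remainder3_near_0 (y : R) :
  41 / 2048 < y -> exists x, 0 < x < 1 /\ remainder 3 taylor3 x < y.
Proof.
intros Hy.
destruct (remainder_near_0 _ _ _ _ _ truncation_3 pos_bounded_3)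
  as [C [HC Hnear]].
destruct (linear_small C (y - 41 / 2048) (/ 2) HC ltac:(lra) ltac:(lra))
  as [x [Hx1 Hx2]].
exists x; split; [lra |].
pose proof (Rle_abs (remainder 3 taylor3 x - 41 / 2048)).
pose proof (Hnear x Hx1); lra.
Qed.

Lemma remainder3_onto (y : R) : 41 / 2048 < y < 13 / 32 ->
  exists x, 0 < x < 1 /\ remainder 3 taylor3 x = y.
Proof.
intros [Hy0 Hy1].
destruct (remainder3_near_0 y Hy0) as [a [Ha Hya]].
destruct (remainder3_near_1 y Hy1) as [b [Hb Hyb]].
assert (Hab : a < b).
{ apply Rnot_le_lt; intros [Hba | Hba]; [| subst; lra].
  pose proof (remainder3_increasing b a ltac:(lra) Hba ltac:(lra)); lra. }
destruct (Ranalysis5.IVT_interv (fun x => remainder 3 taylor3 x - y) a b)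
  as [x [Hx Heq]]; [| exact Hab | lra | lra |].
- intros x Hx.
  apply continuity_pt_minus; [| now apply continuity_pt_const].
  apply continuity_pt_filterlim.
  apply (ex_derive_continuous (remainder 3 taylor3)); eexists.
  apply (is_derive_remainder _ _ _ _ _ x truncation_3); lra.
- exists x; split; lra.
Qed.

(** * Return to the modulus [r] *)

(** Division by [ellK] turns the bracket of [f18] into [ellW - taylor3] at [r ^ 2], and
    [r ^ 8 = (r ^ 2) ^ 4]. *)
Lemma f19_remainder (r : R) :
  0 < r < 1 -> f19 r = remainder 3 taylor3 (r ^ 2).
Proof.
intros Hr.
assert (Hx : 0 < r ^ 2 < 1) by (simpl; nra).
pose proof (ellK_pos _ Hx).
unfold f19, f18, remainder, ellW, taylor3.
change (ellipticK r) with (ellK (r ^ 2)).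
change (ellipticE r) with (ellE (r ^ 2)).
field; lra.
Qed.

Theorem theorem3p1 :
  (forall r s : R, 0 < r -> r < s -> s < 1 -> f19 r < f19 s) /\
  (forall y : R, (exists r : R, 0 < r < 1 /\ f19 r = y) <->
                 41 / 2048 < y < 13 / 32) /\
  (forall r : R, 0 < r < 1 ->
     P r < ellipticE r / ellipticK r < Q r) /\
  (forall r : R, 0 < r < 1 ->
     P r = (1 - r ^ 2) * (1 + r ^ 2 * ((16 + 14 * r ^ 2 + 13 * r ^ 4) / 32))).
Proof.
assert (Hsq : forall r, 0 < r < 1 -> 0 < r ^ 2 < 1) by (intros; simpl; nra).
split; [| split; [| split]].
- intros r s Hr Hrs Hs; rewrite !f19_remainder by lra.
  pose proof (Hsq r ltac:(lra)); pose proof (Hsq s ltac:(lra)).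
  apply remainder3_increasing; [lra | simpl; nra | lra].
- intros y; split.
  + intros [r [Hr <-]]; rewrite f19_remainder by exact Hr.
    split; [apply remainder3_gt | apply remainder3_lt]; now apply Hsq.
  + intros Hy; destruct (remainder3_onto y Hy) as [x [Hx Hxy]].
    assert (Hs : 0 < sqrt x) by (apply sqrt_lt_R0; lra).
    assert (Hss : sqrt x ^ 2 = x) by (apply pow2_sqrt; lra).
    assert (Hr : 0 < sqrt x < 1) by (split; [| simpl in Hss]; nra).
    exists (sqrt x); split; [exact Hr |].
    now rewrite f19_remainder, Hss.
- intros r Hr; pose proof (Hsq r Hr) as Hx.
  pose proof (remainder3_gt _ Hx); pose proof (remainder3_lt _ Hx).
  (* This expresses [ellE / ellK] at [r ^ 2] as [1 - taylor3 (r ^ 2) - g * r ^ 8]; the lower bound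
     on [g] gives [Q] and the upper one gives [P]. *)
  pose proof (ellW_remainder 3 taylor3 (r ^ 2) ltac:(lra)) as Hw.
  change (ellipticE r / ellipticK r) with (ellE (r ^ 2) / ellK (r ^ 2)).
  unfold ellW in Hw.
  assert (H8 : 0 < r ^ 8) by (apply pow_lt; lra).
  replace ((r ^ 2) ^ 4) with (r ^ 8) in Hw by ring.
  unfold P, Q; unfold taylor3 at 1 in Hw.
  set (g := remainder 3 taylor3 (r ^ 2)) in *.
  replace ((r ^ 2) ^ 2) with (r ^ 4) in Hw by ring.
  replace ((r ^ 2) ^ 3) with (r ^ 6) in Hw by ring.
  assert (41 / 2048 * r ^ 8 < g * r ^ 8) by (apply Rmult_lt_compat_r; lra).
  assert (g * r ^ 8 < 13 / 32 * r ^ 8) by (apply Rmult_lt_compat_r; lra).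
  split; lra.
- intros r _; unfold P; field.
Qed.
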